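(* Let $k\ge 1$ and $1\le h\le k$ be integers with $h$ dividing $k$. There is a constant $\mu$, independent of $k$, with the following property. Let $\mathcal{S}$ be a finite set of at least $k$ mutually independent candidates. For each candidate $X$ let $E_X$ be the event that $X$ takes a value in its top $h/k$ quantile, i.e. in the quantile representation, $E_X=\{\omega\in[0,1]:\omega>1-h/k\}$. Let $\{X_1,\dots,X_k\}\subseteq\mathcal{S}$ be a $k$-element subset with the $k$ highest values of $\mathbb{E}(X\mid E_X)$ (i.e. $\mathbb{E}(X_i\mid E_{X_i})\ge \mathbb{E}(Z\mid E_Z)$ for all $i$ and all $Z\in\mathcal{S}\setminus\{X_1,\dots,X_k\}$), and let $\{Y_1,\dots,Y_k\}\subseteq\mathcal{S}$ be a $k$-element subset maximizing $g_h$. Then $g_h(Y_1,\dots,Y_k)\le \mu\, g_h(X_1,\dots,X_k)$.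
   Context: A candidate is a nonnegative discrete random variable $X$ taking finitely many positive values $x_1>\dots>x_n$ with probabilities $p_1,\dots,p_n$ ($\sum p_i\le1$) and $0$ otherwise. Let $q_l=p_1+\dots+p_l$, $q_0=0$. Quantile representation: on the sample space $[0,1]$ with Lebesgue measure, $X(\omega)=x_l$ if $1-q_l<\omega\le 1-q_{l-1}$ and $X(\omega)=0$ if $\omega\le 1-q_n$; this has the same distribution as $X$. For candidates $X_1,\dots,X_k$, $g_h(X_1,\dots,X_k)$ is the expected sum of the $h$ largest values among $X_1,\dots,X_k$. *)

(* Defs.v *)
From HB Require Import structures.
From mathcomp Require Import all_boot all_order all_algebra.
From mathcomp Require Import all_classical all_reals all_analysis.

Set Implicit Arguments.
Unset Strict Implicit.
Unset Printing Implicit Defensive.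

Import Order.TTheory GRing.Theory Num.Theory.
Import numFieldNormedType.Exports.

Local Open Scope classical_set_scope.
Local Open Scope ring_scope.

(* The sequence [cand_vals X] lists x_1 > ... > x_n; as sequences are indexed
   from 0, x_l is [(cand_vals X)`_l.-1]. *)
Record candidate (d : measure_display) (T : measurableType d) (R : realType)
    (P : probability T R) := Candidate {
  cand_rv : {RV P >-> R};
  cand_vals : seq R;
  cand_vals_sorted : sorted >%R cand_vals;
  cand_vals_gt0 : all (fun x => 0 < x) cand_vals;
  cand_range : forall w, cand_rv w \in 0 :: cand_vals
}.

(* [cand_prob X l] is p_(l+1). *)
Definition cand_prob (d : measure_display) (T : measurableType d)
    (R : realType) (P : probability T R) (X : candidate P) (l : nat) : R :=
  fine (P (cand_rv X @^-1` [set (cand_vals X)`_l])).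

(* [cand_cumul X l] is q_l = p_1 + ... + p_l. *)
Definition cand_cumul (d : measure_display) (T : measurableType d)
    (R : realType) (P : probability T R) (X : candidate P) (l : nat) : R :=
  \sum_(i < l) cand_prob X i.

(* The index l : 'I_n stands for l+1 in the 1-based numbering; the intervals
   ]1 - q_(l+1), 1 - q_l] are pairwise disjoint, so at most one l qualifies. *)
Definition quantile_rep (d : measure_display) (T : measurableType d)
    (R : realType) (P : probability T R) (X : candidate P) (w : R) : R :=
  if [pick l : 'I_(size (cand_vals X)) |
        1 - cand_cumul X l.+1 < w <= 1 - cand_cumul X l] is Some l
  then (cand_vals X)`_l else 0.

Definition top_quantile (R : realType) (h k : nat) : set R :=
  [set w | 0 <= w <= 1 /\ 1 - h%:R / k%:R < w].

(* E(X | E_X), computed in the quantile representation; since E_X is contained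
   in [0, 1], Lebesgue measure on the line may be used. *)
Definition top_quantile_mean (d : measure_display) (T : measurableType d)
    (R : realType) (P : probability T R) (h k : nat) (X : candidate P) : R :=
  Rintegral (@lebesgue_measure R) (top_quantile h k) (quantile_rep X)
    / fine (@lebesgue_measure R (top_quantile h k)).

Definition mutually_independent (d : measure_display) (T : measurableType d)
    (R : realType) (P : probability T R) (S : finType)
    (X : S -> candidate P) : Prop :=
  forall (J : {set S}) (A : S -> set R), (forall i, measurable (A i)) ->
    fine (P (\bigcap_(i in [set` J]) (cand_rv (X i) @^-1` A i))) =
    \prod_(i in J) fine (P (cand_rv (X i) @^-1` A i)).

Definition sum_largest (R : realType) (h : nat) (s : seq R) : R :=
  \sum_(x <- take h (sort >=%R s)) x.

Definition expected_top (d : measure_display) (T : measurableType d)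
    (R : realType) (P : probability T R) (S : finType)
    (X : S -> candidate P) (h : nat) (A : {set S}) : \bar R :=
  expectation P (fun w => sum_largest h [seq cand_rv (X i) w | i <- enum A]).

(* Main.v *)
Require Import Defs.
From HB Require Import structures.
From mathcomp Require Import all_boot all_order all_algebra.
From mathcomp Require Import all_classical all_reals all_analysis.
From mathcomp Require Import measurable_realfun ring lra.

(** The constant is mu = 5. Put a = h/k, let M_i = E(X_i 1_{E_i}) be the mass of
X_i in its top quantile, and let m be the least M_i / a over the chosen set X.
The sum of the h largest among nonnegative numbers x_i is the minimum over
t >= 0 of h t + sum_i (x_i - t)^+.

Upper bound: taking t + m for Y, with t optimal for X, bounds the top sum of Y
by that of X plus h m plus the sum over Y \ X of (X_j - m)^+. As M_j <= a m for
j outside X, values of X_j above m lie in its top quantile, so that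
E (X_j - m)^+ <= M_j <= a m; hence g_h(Y) <= g_h(X) + 2 h m.

Lower bound: let W_i in [0, 1] select the top quantile of X_i, and N be the sum
of the W_i over X. The weights (1 - N / 4h) W_i add up to at most h, so the top
sum of X is at least (1 - N / 4h) sum_i W_i X_i. Pairwise independence and
E W_j <= a bound the mean of the latter below by (sum_i M_i) / 2 >= h m / 2. *)

Set Implicit Arguments.
Unset Strict Implicit.
Unset Printing Implicit Defensive.

Import Order.TTheory GRing.Theory Num.Theory.

(** * Sums of the h largest entries, by thresholds *)

Section SumLargest.
Local Open Scope ring_scope.

Context (R : realType).
Implicit Types (s : seq R) (t : R) (h : nat).

(** Each of the top entries is at most [t] plus its excess over [t]; as [t] is nonnegative, a list
    with fewer than [h] entries does no harm. *)
Lemma sum_largest_le h s t : 0 <= t ->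
  sum_largest h s <= h%:R * t + \sum_(x <- s) Num.max (x - t) 0.
Proof.
move=> t0; rewrite /sum_largest [X in _ + X](perm_big (sort >=%R s)) /=;
  last by rewrite perm_sym perm_sort.
set s' := sort _ s; rewrite -[s' in leRHS](cat_take_drop h) big_cat /=.
have -> : \sum_(x <- take h s') x = \sum_(x <- take h s') (t + (x - t)).
  by apply: eq_bigr => x _; rewrite addrC subrK.
rewrite big_split /= addrA -[leLHS]addr0; apply: lerD; last first.
  by rewrite sumr_ge0// => x _; rewrite le_max lexx orbT.
apply: lerD; last by apply: ler_sum => x _; rewrite le_max lexx.
rewrite big_const_seq count_predT iter_addr addr0 -[t *+ _]mulr_natl.
by rewrite ler_wpM2r// ler_nat size_take_min geq_minl.
Qed.

Lemma sum_largest_attained h s : all (fun x => 0 <= x) s ->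
  exists2 t, 0 <= t &
    h%:R * t + \sum_(x <- s) Num.max (x - t) 0 <= sum_largest h s.
Proof.
move=> s0; rewrite /sum_largest.
suff [t t0 H] : exists2 t, 0 <= t & h%:R * t +
    \sum_(x <- sort >=%R s) Num.max (x - t) 0 <=
    \sum_(x <- take h (sort >=%R s)) x.
  by exists t => //; rewrite (perm_big (sort >=%R s)) //= perm_sym perm_sort.
have s'0 : all (fun x => 0 <= x) (sort >=%R s) by rewrite all_sort.
have : sorted >=%R (sort >=%R s).
  by apply: sort_sorted => x y; rewrite /= le_total.
move: s'0; move: (sort _ s) => {s0}s s0 ss.
have ge_trans : transitive (>=%R : rel R).
  by move=> y x z /= xy /le_trans; apply.
have ge_refl : reflexive (>=%R : rel R) by move=> x /=.
(* This is the (h+1)-th largest entry: the entries before it are at least the threshold, and from it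
   on there is no excess. With at most [h] entries the default 0 serves, the top sum being the full
   sum. *)
exists s`_h.
  by have [/(all_nthP 0 s0)//|/(nth_default 0)->] := ltnP h (size s).
have [hs|hs] := leqP (size s) h.
  rewrite (nth_default 0 hs) take_oversize// mulr0 add0r.
  rewrite !big_seq; apply: ler_sum => x /(allP s0) x0.
  by rewrite subr0 max_l.
rewrite -[X in \sum_(x <- X) Num.max _ _](cat_take_drop h) big_cat /=.
rewrite [X in _ + (_ + X)]big_seq [X in _ + (_ + X)]big1 ?addr0; last first.
  move=> x /(nthP 0) [i]; rewrite size_drop nth_drop => ih <-.
  rewrite max_r// subr_le0; apply: (sorted_leq_nth ge_trans ge_refl 0 ss) => //.
  - by rewrite inE -ltn_subRL.
  - exact: leq_addr.
have hE : h%:R = \sum_(x <- take h s) (1 : R).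
  by rewrite big_const_seq count_predT size_takel ?(ltnW hs)// iter_addr addr0.
rewrite hE mulr_suml -big_split /= !big_seq.
apply: ler_sum => x /(nthP 0) [i]; rewrite size_takel ?(ltnW hs)// => ih <-.
rewrite nth_take// mul1r max_l ?subr_ge0.
  by rewrite addrC subrK.
apply: (sorted_leq_nth ge_trans ge_refl 0 ss) => //; last exact: ltnW.
by rewrite inE (ltn_trans ih).
Qed.

End SumLargest.

(** * Expectations as finite sums *)

Section FiniteRange.
Local Open Scope classical_set_scope.
Local Open Scope ring_scope.

(** The range carries no measurable structure, so measurability is asked of the fibres; [V] may then
    be one value, a pair or a whole vector of values. *)
Lemma expectation_seq (d : measure_display) (T : measurableType d)
    (R : realType) (P : probability T R) (F : eqType) (s : seq F) (V : T -> F)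
    (f : F -> R) :
  uniq s -> (forall w, V w \in s) -> (forall v, measurable (V @^-1` [set v])) ->
  expectation P (f \o V) =
  (\sum_(v <- s) f v * fine (P (V @^-1` [set v])))%:E.
Proof.
move=> us Vs mV; rewrite unlock.
transitivity (\int[P]_w
    (\sum_(v <- s) (f v)%:E * (\1_(V @^-1` [set v]) w)%:E)%E)%E.
  apply: eq_integral => w _.
  rewrite (bigD1_seq (V w))//= indicE mem_set// mule1 big1 ?adde0// => v vw.
  by rewrite indicE memNset ?mule0//= => wv; rewrite wv eqxx in vw.
rewrite integral_sum//; last first.
  by move=> v; apply: integrableZl => //; exact: integrable_indic.
rewrite -sumEFin; apply: eq_bigr => v _.
rewrite integralZl//; last exact: integrable_indic.
by rewrite integral_indic// setIT EFinM fineK// fin_num_measure.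
Qed.

End FiniteRange.

(** * Top-quantile mass of a single candidate *)

Section Candidate.
Local Open Scope classical_set_scope.
Local Open Scope ring_scope.

Context (d : measure_display) (T : measurableType d) (R : realType)
  (P : probability T R).
Implicit Types (X : candidate P) (a m x w : R) (l n : nat).

(** The part of the atom of index [l] inside the top quantile of mass [a], written as a difference
    so that totals telescope. *)
Definition truncated_prob X a l : R :=
  Num.min (cand_cumul X l.+1) a - Num.min (cand_cumul X l) a.

(** The unnormalised mean E(X 1_E), for E the top quantile of mass [a]. *)
Definition top_mass X a : R :=
  \sum_(l < size (cand_vals X)) (cand_vals X)`_l * truncated_prob X a l.

(* The share of the atom [X = x] that lies in the top quantile of mass [a]:
   it replaces the indicator of E_X, which need not be an event of [T]. *)
Definition top_weight X a x : R :=
  if x \in cand_vals X then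
    truncated_prob X a (index x (cand_vals X)) /
      cand_prob X (index x (cand_vals X))
  else 0.

Lemma cand_prob_ge0 X l : 0 <= cand_prob X l.
Proof. by rewrite /cand_prob fine_ge0. Qed.

Lemma cand_cumulS X l : cand_cumul X l.+1 = cand_cumul X l + cand_prob X l.
Proof. by rewrite /cand_cumul big_ord_recr. Qed.

Lemma cand_cumul_homo X : {homo cand_cumul X : m n / (m <= n)%N >-> m <= n}.
Proof.
apply: homo_leq => [//|? ? ?|l]; first exact: le_trans.
by rewrite cand_cumulS lerDl cand_prob_ge0.
Qed.

Lemma cand_vals_nth_gt0 X l : (l < size (cand_vals X))%N ->
  0 < (cand_vals X)`_l.
Proof. exact: (all_nthP 0 (cand_vals_gt0 X)). Qed.

Lemma cand_vals_nth_anti X j l : (j <= l)%N -> (l < size (cand_vals X))%N ->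
  (cand_vals X)`_l <= (cand_vals X)`_j.
Proof.
rewrite leq_eqVlt => /predU1P[-> //|jl] ln; apply: ltW.
have gt_trans : transitive (>%R : rel R).
  by move=> y x z /= xy /lt_trans; apply.
apply: (sorted_ltn_nth gt_trans 0 (cand_vals_sorted X)) => //.
by rewrite inE (ltn_trans jl).
Qed.

Lemma cand_vals_uniq X : uniq (cand_vals X).
Proof.
apply: (sorted_uniq _ _ (cand_vals_sorted X)) => [y x z /= xy /lt_trans|x /=].
  by apply.
by rewrite ltxx.
Qed.

Lemma cand_vals_notin0 X : 0 \notin cand_vals X.
Proof. by apply/negP => /(allP (cand_vals_gt0 X)); rewrite ltxx. Qed.

Lemma truncated_prob_ge0 X a l : 0 <= truncated_prob X a l.
Proof.
have := cand_cumul_homo X (leqnSn l); rewrite /truncated_prob => q.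
by case: (leP _ a) => ?; case: (leP _ a) => ?; lra.
Qed.

Lemma truncated_prob_le X a l : truncated_prob X a l <= cand_prob X l.
Proof.
have := cand_prob_ge0 X l; rewrite /truncated_prob cand_cumulS => p.
by case: (leP (_ + _) a) => ?; case: (leP (cand_cumul X l) a) => ?; lra.
Qed.

Lemma truncated_prob_id X a l :
  cand_cumul X l.+1 <= a -> truncated_prob X a l = cand_prob X l.
Proof.
have := cand_prob_ge0 X l; rewrite /truncated_prob cand_cumulS => p q.
by case: (leP (_ + _) a) => ?; case: (leP (cand_cumul X l) a) => ?; lra.
Qed.

Lemma sum_truncated_prob X a n : 0 <= a ->
  \sum_(l < n) truncated_prob X a l = Num.min (cand_cumul X n) a.
Proof.
move=> a0; rewrite -(big_mkord xpredT (truncated_prob X a)) telescope_sumr//.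
by rewrite {2}/cand_cumul big_ord0 (min_l a0) subr0.
Qed.

Lemma top_mass_ge0 X a : 0 <= top_mass X a.
Proof.
apply: sumr_ge0 => l _.
by rewrite mulr_ge0 ?truncated_prob_ge0 ?ltW ?cand_vals_nth_gt0.
Qed.

(* A value above [m] lies entirely in the top quantile, as otherwise all the
   mass [a] would sit on values above [m], against [top_mass X a <= a * m]. *)
Lemma sum_excess_le_top_mass X a m : 0 < a -> top_mass X a <= a * m ->
  \sum_(l < size (cand_vals X))
    Num.max ((cand_vals X)`_l - m) 0 * cand_prob X l <= top_mass X a.
Proof.
move=> a0 tm; apply: ler_sum => l _.
have m0 : 0 <= m.
  by rewrite -(pmulr_rge0 _ a0) (le_trans (top_mass_ge0 X a)).
have x0 := cand_vals_nth_gt0 (ltn_ord l).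
have t0 := truncated_prob_ge0 X a l.
have [xm|mx] := leP (cand_vals X)`_l m.
  by rewrite max_r ?subr_le0// mul0r mulr_ge0// ltW.
have [qa|aq] := leP (cand_cumul X l.+1) a.
  rewrite truncated_prob_id// ler_wpM2r ?cand_prob_ge0//.
  by rewrite max_l ?gerBl// subr_ge0 ltW.
exfalso; suff : a * (cand_vals X)`_l <= top_mass X a.
  by move=> /le_trans/(_ tm); rewrite ler_pM2l// leNgt mx.
(* As q_(l+1) > a, the atoms up to index [l] exhaust the quantile. *)
rewrite {1}(_ : a = \sum_(j < l.+1) truncated_prob X a j); last first.
  by rewrite sum_truncated_prob ?ltW// min_r ?ltW.
rewrite mulr_suml.
pose G j := (cand_vals X)`_j * truncated_prob X a j.
apply: (@le_trans _ _ (\sum_(j < l.+1) G j)).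
  apply: ler_sum => j _; rewrite mulrC ler_wpM2r ?truncated_prob_ge0//.
  by rewrite cand_vals_nth_anti// -ltnS.
rewrite /top_mass -!(big_mkord xpredT G).
rewrite -[leLHS]addr0 [leRHS](@big_cat_nat _ _ _ l.+1)//= lerD2l.
rewrite big_nat sumr_ge0// => j /andP[_ jn].
by rewrite mulr_ge0 ?truncated_prob_ge0 ?ltW ?cand_vals_nth_gt0.
Qed.

Lemma top_weight0 X a : top_weight X a 0 = 0.
Proof. by rewrite /top_weight (negPf (cand_vals_notin0 X)). Qed.

Lemma top_weight_prob X a l : (l < size (cand_vals X))%N ->
  top_weight X a (cand_vals X)`_l * cand_prob X l = truncated_prob X a l.
Proof.
move=> ln; rewrite /top_weight mem_nth// index_uniq ?cand_vals_uniq//.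
(* For an atom of probability 0 the division is degenerate, but both sides vanish. *)
have [p0|p0] := eqVneq (cand_prob X l) 0; last by rewrite divfK.
rewrite p0 mulr0; apply/esym/eqP.
by rewrite eq_le truncated_prob_ge0 -p0 truncated_prob_le.
Qed.

Lemma top_weight_ge0 X a x : 0 <= top_weight X a x.
Proof.
rewrite /top_weight; case: ifP => // _.
by rewrite divr_ge0 ?truncated_prob_ge0 ?cand_prob_ge0.
Qed.

Lemma top_weight_le1 X a x : top_weight X a x <= 1.
Proof.
rewrite /top_weight; case: ifP => // _; set l := index _ _.
have [p0|p0] := eqVneq (cand_prob X l) 0; first by rewrite p0 invr0 mulr0.
by rewrite ler_pdivrMr ?lt0r ?p0 ?cand_prob_ge0// mul1r truncated_prob_le.
Qed.

Lemma measurable_cand_preimage X (B : set R) :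
  measurable B -> measurable (cand_rv X @^-1` B).
Proof.
by move=> mB; rewrite -[X in measurable X]setTI; exact: measurable_funP.
Qed.

(** The condition on [g] removes the value 0, which is not listed in [cand_vals]. *)
Lemma expectation_cand X (g : R -> R) : g 0 = 0 ->
  expectation P (g \o cand_rv X) =
  (\sum_(l < size (cand_vals X)) g (cand_vals X)`_l * cand_prob X l)%:E.
Proof.
move=> g0; rewrite (@expectation_seq _ _ _ _ _ (0 :: cand_vals X)).
- by rewrite big_cons g0 mul0r add0r (big_nth 0) big_mkord.
- by rewrite /= cand_vals_notin0 cand_vals_uniq.
- exact: cand_range.
- by move=> v; exact: measurable_cand_preimage.
Qed.

(** Disjointness of the intervals turns the choice of an index into a sum of indicators, which can
    be integrated termwise. *)
Lemma quantile_repE X w : quantile_rep X w =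
  \sum_(l < size (cand_vals X)) (cand_vals X)`_l *
    \1_(`]1 - cand_cumul X l.+1, 1 - cand_cumul X l]%classic) w.
Proof.
rewrite /quantile_rep; case: pickP => [l lw|nw].
  rewrite (bigD1 l)//= indicE mem_set /= ?in_itv//= mulr1 big1 ?addr0// => j jl.
  rewrite indicE memNset ?mulr0//= in_itv /= => jw.
  move: jl; rewrite -val_eqE neq_ltn => /orP[] /(cand_cumul_homo X).
    by move: lw jw => /andP[? ?] /andP[? ?]; lra.
  by move: lw jw => /andP[? ?] /andP[? ?]; lra.
rewrite big1// => j _.
by rewrite indicE memNset ?mulr0//= in_itv /= nw.
Qed.

Lemma top_quantileE (h k : nat) : (h <= k)%N -> 
  top_quantile h k = `]1 - h%:R / k%:R, 1]%classic :> set R.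
Proof.
move=> hk; apply/seteqP; split => w /=; rewrite in_itv /=.
  by move=> [/andP[_ ->] ->].
move=> /andP[hw w1]; split => //; rewrite w1 andbT.
rewrite ltW// (le_lt_trans _ hw)// subr_ge0.
have [->|k0] := posnP k; first by rewrite invr0 mulr0.
by rewrite ler_pdivrMr ?ltr0n// mul1r ler_nat.
Qed.

(** Lets the ranking by conditional means be read as a ranking by top masses. *)
Lemma top_quantile_meanE X (h k : nat) : (0 < h)%N -> (h <= k)%N ->
  top_quantile_mean h k X = top_mass X (h%:R / k%:R) / (h%:R / k%:R).
Proof.
move=> h0 hk; rewrite /top_quantile_mean top_quantileE//.
set a : R := h%:R / k%:R.
have a0 : 0 < a by rewrite divr_gt0// ltr0n// (leq_trans h0).
congr (_ / _); last first.
  by rewrite lebesgue_measure_itv /= lte_fin ifT ?gtrBl//= opprB addrC subrK.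
rewrite /Rintegral.
under eq_integral do rewrite quantile_repE -sumEFin.
have mI (l : nat) : measurable
    (`]1 - cand_cumul X l.+1, 1 - cand_cumul X l]%classic : set R) by [].
rewrite ge0_integral_sum//; last 2 first.
- move=> l; apply/measurable_EFinP; apply: measurable_funM => //.
- by move=> l x _; rewrite lee_fin mulr_ge0// ltW// cand_vals_nth_gt0.
rewrite (eq_bigr (fun l : 'I_(size (cand_vals X)) =>
  ((cand_vals X)`_l * truncated_prob X a l)%:E)) ?sumEFin// => l _.
under eq_integral do rewrite EFinM.
rewrite ge0_integralZl//; last 2 first.
- by apply/measurable_EFinP; exact: measurable_indic.
- by rewrite lee_fin ltW// cand_vals_nth_gt0.
rewrite integral_indic// EFinM; congr (_ * _)%E.
have q0 : 0 <= cand_cumul X l.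
  by apply: sumr_ge0 => i _; exact: cand_prob_ge0.
have qS := cand_cumul_homo X (leqnSn l).
(* If q_l >= a, this interval is empty and the truncated probability is 0. *)
rewrite (_ : _ `&` _ = `]1 - Num.min (cand_cumul X l.+1) a,
    1 - cand_cumul X l]%classic); last first.
  apply/seteqP; split => w /=; rewrite !in_itv /=.
    move=> [/andP[? ?] /andP[? ?]].
    by case: (leP _ a) => ?; apply/andP; split; lra.
  by case: (leP _ a) => ? /andP[? ?]; split; apply/andP; split; lra.
rewrite [LHS](lebesgue_measure_itv _) /= lte_fin /truncated_prob.
by case: (leP _ a) => ?; case: (leP _ a) => ?; case: ltP => ?;
  rewrite -?EFinB; congr EFin; lra.
Qed.

End Candidate.

(** * Pointwise inequalities for top sums over index sets *)

Section SumLargestSet.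
Local Open Scope ring_scope.

Context (R : realType) (S : finType).
Implicit Types (A B : {set S}) (x u : S -> R) (m : R) (h : nat).

Lemma sum_largest_set_le h A x t : 0 <= t ->
  sum_largest h [seq x i | i <- enum A] <=
  h%:R * t + \sum_(i in A) Num.max (x i - t) 0.
Proof.
move=> /sum_largest_le - /(_ h [seq x i | i <- enum A]).
by rewrite big_map big_enum.
Qed.

Lemma sum_largest_set_attained h A x : (forall i, 0 <= x i) ->
  exists2 t, 0 <= t & h%:R * t + \sum_(i in A) Num.max (x i - t) 0 <=
    sum_largest h [seq x i | i <- enum A].
Proof.
move=> x0; have [|t t0] := @sum_largest_attained R h [seq x i | i <- enum A].
  by apply/allP => _ /mapP[i _ ->].
by rewrite big_map big_enum => ?; exists t.
Qed.

Lemma max0_ge0 (y : R) : 0 <= Num.max y 0.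
Proof. by rewrite le_max lexx orbT. Qed.

(** Use the threshold t + m for [B], with t optimal for [A]: drop m from it on the common indices
    and t on the others. *)
Lemma sum_largest_exchange h A B x m : (forall i, 0 <= x i) -> 0 <= m ->
  sum_largest h [seq x i | i <- enum B] <=
  sum_largest h [seq x i | i <- enum A] +
  (h%:R * m + \sum_(i in B :\: A) Num.max (x i - m) 0).
Proof.
move=> x0 m0; have [t t0 tA] := sum_largest_set_attained h A x0.
have := sum_largest_set_le h B x (addr_ge0 t0 m0).
move=> /le_trans; apply; apply: le_trans (lerD tA (lexx _)).
rewrite mulrDr addrACA lerD2l (big_setID A) /=; apply: lerD.
  apply: (@le_trans _ _ (\sum_(i in B :&: A) Num.max (x i - t) 0)).
    by apply: ler_sum => i _; rewrite le_max2// lerB// lerDl.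
  rewrite [leRHS](big_setID B) /= finset.setIC lerDl.
  by apply: sumr_ge0 => i _; exact: max0_ge0.
by apply: ler_sum => i _; rewrite le_max2// lerB// lerDr.
Qed.

(* The coefficients [(1 - N / 4h) * u i], with N the sum of the [u i], lie in
   [0, 1] and add up to at most [h]; denominators are cleared. *)
Lemma sum_largest_weighted h A x u :
  (forall i, 0 <= x i) -> (forall i, 0 <= u i <= 1) ->
  (4 * h%:R - \sum_(i in A) u i) * \sum_(i in A) x i * u i <=
  4 * h%:R * sum_largest h [seq x i | i <- enum A].
Proof.
move=> x0 u01; have [t t0 tA] := sum_largest_set_attained h A x0.
have h0 : 0 <= h%:R :> R by [].
apply: le_trans (ler_wpM2l _ tA); last by rewrite mulr_ge0.
set N := \sum_(i in A) u i; set W := \sum_(i in A) x i * u i.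
set M := \sum_(i in A) Num.max _ _.
have N0 : 0 <= N by apply: sumr_ge0 => i _; case/andP: (u01 i).
have M0 : 0 <= M by apply: sumr_ge0 => i _; exact: max0_ge0.
have W0 : 0 <= W.
  by apply: sumr_ge0 => i _; rewrite mulr_ge0//; case/andP: (u01 i).
(* Termwise, x u <= t u + (x - t)^+ because 0 <= u <= 1. *)
have WM : W <= N * t + M.
  rewrite /W /N /M mulr_suml -big_split /=; apply: ler_sum => i _.
  have /andP[u0 u1] := u01 i; have := x0 i; rewrite maxEle.
  by case: ifP => [|/negbT]; rewrite -?ltNge => ? ?; nra.
have [Nh|hN] := leP (4 * h%:R) N.
  apply: (@le_trans _ _ 0); last by rewrite !(mulr_ge0, addr_ge0).
  by rewrite mulr_le0_ge0// subr_le0.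
apply: le_trans (ler_wpM2l _ WM) _; first by rewrite subr_ge0 ltW.
rewrite !mulrDr; apply: lerD; last by rewrite ler_wpM2r// gerBl.
rewrite !mulrA ler_wpM2r//.
(* The bound (4h - N) N <= 4h^2 is the nonnegativity of this square. *)
have := sqr_ge0 (N - 2 * h%:R); rewrite expr2; nra.
Qed.

End SumLargestSet.

(** * The joint law as a finite sum *)

Section JointLaw.
Local Open Scope classical_set_scope.
Local Open Scope ring_scope.

Context (d : measure_display) (T : measurableType d) (R : realType)
  (P : probability T R) (S : finType) (C : S -> candidate P).
Implicit Types (i j : S) (A : {set S}) (f g : (S -> R) -> R) (c : R).

(** A common finite range for all candidates, so that the joint outcomes form a finite type. *)
Definition joint_support : seq R :=
  0 :: flatten [seq cand_vals (C i) | i <- enum S].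

Lemma cand_rv_joint_support i w : cand_rv (C i) w \in joint_support.
Proof.
have := cand_range (C i) w; rewrite !inE => /orP[->//|wi].
apply/orP; right; apply/flattenP; exists (cand_vals (C i)) => //.
by rewrite map_f// mem_enum.
Qed.

Definition joint_rv (w : T) : {ffun S -> seq_sub joint_support} :=
  [ffun i => SeqSub (cand_rv_joint_support i w)].

Definition joint_val (v : {ffun S -> seq_sub joint_support}) (i : S) : R :=
  ssval (v i).

Definition joint_prob v : R := fine (P (joint_rv @^-1` [set v])).

Definition joint_mean (f : (S -> R) -> R) : R :=
  \sum_v f (joint_val v) * joint_prob v.

Lemma expectation_joint f :
  expectation P (fun w => f (fun i => cand_rv (C i) w)) = (joint_mean f)%:E.
Proof.
have -> : (fun w => f (fun i => cand_rv (C i) w)) =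
    (fun v => f (joint_val v)) \o joint_rv.
  apply/funext => w /=; congr f; apply/funext => i.
  by rewrite /joint_val ffunE.
rewrite (@expectation_seq _ _ _ _ _ (index_enum _)) ?index_enum_uniq//.
move=> v; have -> : joint_rv @^-1` [set v] =
    \bigcap_(i in [set: S]) (cand_rv (C i) @^-1` [set joint_val v i]).
  apply/seteqP; split => w /=.
    by move=> <- i _ /=; rewrite /joint_val ffunE.
  move=> wv; apply/ffunP => i; apply/val_inj.
  by rewrite ffunE /= (wv i I).
apply: fin_bigcap_measurable => // i _; exact: measurable_cand_preimage.
Qed.

Lemma joint_prob_ge0 v : 0 <= joint_prob v.
Proof. exact: fine_ge0. Qed.

Lemma joint_val_ge0 v i : 0 <= joint_val v i.
Proof.
rewrite /joint_val; case: (v i) => x /=; rewrite inE => /predU1P[->//|].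
move=> /flattenP[s /mapP[j _ ->]] /(allP (cand_vals_gt0 (C j))).
exact: ltW.
Qed.

(** Comparison at nonnegative vectors suffices, since every joint outcome is one. *)
Lemma joint_mean_le f g : (forall x, (forall i, 0 <= x i) -> f x <= g x) ->
  joint_mean f <= joint_mean g.
Proof.
move=> fg; apply: ler_sum => v _; rewrite ler_wpM2r ?joint_prob_ge0//.
by apply: fg; exact: joint_val_ge0.
Qed.

Lemma joint_mean_cst c : joint_mean (fun=> c) = c.
Proof.
by apply: EFin_inj; rewrite -expectation_joint expectation_cst.
Qed.

Lemma joint_meanD f g :
  joint_mean (fun x => f x + g x) = joint_mean f + joint_mean g.
Proof. by rewrite -big_split; apply: eq_bigr => v _; rewrite mulrDl. Qed.

Lemma joint_meanZ c f : joint_mean (fun x => c * f x) = c * joint_mean f.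
Proof. by rewrite mulr_sumr; apply: eq_bigr => v _; rewrite mulrA. Qed.

Lemma joint_mean_sum A (f : S -> (S -> R) -> R) :
  joint_mean (fun x => \sum_(i in A) f i x) = \sum_(i in A) joint_mean (f i).
Proof.
rewrite /joint_mean exchange_big.
by apply: eq_bigr => v _; rewrite mulr_suml.
Qed.

Lemma expected_topE h A : expected_top C h A =
  (joint_mean (fun x => sum_largest h [seq x i | i <- enum A]))%:E.
Proof. exact: expectation_joint. Qed.

Definition cand_mean i (g : R -> R) : R :=
  \sum_(l < size (cand_vals (C i))) g (cand_vals (C i))`_l * cand_prob (C i) l.

Lemma joint_mean_marginal i (g : R -> R) : g 0 = 0 ->
  joint_mean (fun x => g (x i)) = cand_mean i g.
Proof.
by move=> g0; apply: EFin_inj; rewrite -expectation_joint -expectation_cand.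
Qed.

Lemma joint_mean_pair i j (f g : R -> R) : mutually_independent C -> i != j ->
  f 0 = 0 -> g 0 = 0 ->
  joint_mean (fun x => f (x i) * g (x j)) = cand_mean i f * cand_mean j g.
Proof.
move=> indep ij f0 g0; apply: EFin_inj; rewrite -expectation_joint.
pose V w := (cand_rv (C i) w, cand_rv (C j) w).
have preV x y : V @^-1` [set (x, y)] =
    cand_rv (C i) @^-1` [set x] `&` cand_rv (C j) @^-1` [set y].
  by apply/seteqP; split => w /=; [move=> [<- <-]|rewrite /V => -[-> ->]].
have probV x y : fine (P (V @^-1` [set (x, y)])) =
    fine (P (cand_rv (C i) @^-1` [set x])) *
    fine (P (cand_rv (C j) @^-1` [set y])).
  (* Mutual independence is applied to the pair {i, j} with singleton targets. *)
  pose B n : set R := if n == i then [set x] else [set y].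
  have mB n : measurable (B n) by rewrite /B; case: ifP.
  have := indep [set i; j]%SET B mB.
  rewrite big_setU1 ?inE// big_set1 /= {2 3}/B eqxx eq_sym (negPf ij) => <-.
  rewrite preV; congr (fine (P _)); apply/seteqP; split => w /=.
    move=> [wi wj] n /=; rewrite !inE /B => /orP[/eqP->|/eqP->].
      by rewrite eqxx.
    by rewrite eq_sym (negPf ij).
  move=> wB; split.
    by have := wB i; rewrite /= !inE eqxx /B eqxx; apply.
  by have := wB j; rewrite /= !inE eqxx orbT /B eq_sym (negPf ij); apply.
have -> : (fun w => f (cand_rv (C i) w) * g (cand_rv (C j) w)) =
  (fun p => f p.1 * g p.2) \o V by [].
have us n : uniq (0 :: cand_vals (C n)).
  by rewrite /= cand_vals_notin0 cand_vals_uniq.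
rewrite (@expectation_seq _ _ _ _ _
  [seq (x, y) | x <- 0 :: cand_vals (C i), y <- 0 :: cand_vals (C j)]).
- congr EFin; rewrite big_allpairs big_cons big1 /= ?add0r; last first.
    by move=> y _; rewrite f0 !mul0r.
  rewrite (big_nth 0) big_mkord /cand_mean mulr_suml; apply: eq_bigr => l _.
  rewrite big_cons g0 mulr0 mul0r add0r (big_nth 0) big_mkord mulr_sumr.
  by apply: eq_bigr => l' _; rewrite probV /= mulrACA.
- by apply: allpairs_uniq => // -[? ?] [? ?].
- by move=> w; apply/allpairsP; exists (V w); split => //; exact: cand_range.
- by move=> [x y]; rewrite preV; apply: measurableI;
    exact: measurable_cand_preimage.
Qed.

End JointLaw.

(** * Lower and upper bounds in expectation *)

Section Bounds.
Local Open Scope ring_scope.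

Context (d : measure_display) (T : measurableType d) (R : realType)
  (P : probability T R) (S : finType) (C : S -> candidate P).
Implicit Types (i j : S) (A B : {set S}) (a m : R) (h : nat).

Lemma cand_mean_top_weight i a : 0 <= a ->
  cand_mean C i (top_weight (C i) a) <= a.
Proof.
move=> a0; rewrite /cand_mean.
rewrite (eq_bigr (fun l : 'I_(size (cand_vals (C i))) =>
  truncated_prob (C i) a l)) => [|l _]; last exact: top_weight_prob.
by rewrite sum_truncated_prob// ge_min lexx orbT.
Qed.

Lemma cand_mean_mul_top_weight i a :
  cand_mean C i (fun x => x * top_weight (C i) a x) = top_mass (C i) a.
Proof. by apply: eq_bigr => l _; rewrite -mulrA top_weight_prob. Qed.

(* [E(X_i W_i W_j)] is at most [a * E(X_i W_i)] for [j != i] by independence,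
   and at most [E(X_i W_i)] for [j = i]; hence the mean of [N * sum_i X_i W_i]
   in [sum_largest_weighted] is at most [(1 + h) * sum_i E(X_i W_i)]. *)
Lemma sum_top_mass_le h A a : mutually_independent C ->
  (0 < h)%N -> 0 <= a -> #|A|%:R * a <= h%:R ->
  \sum_(i in A) top_mass (C i) a <=
  2 * joint_mean C (fun x => sum_largest h [seq x i | i <- enum A]).
Proof.
move=> indep h0 a0 Aa.
pose W i x := top_weight (C i) a x.
have W01 i x : 0 <= W i x <= 1 by rewrite top_weight_ge0 top_weight_le1.
have W0 i : W i 0 = 0 by exact: top_weight0.
set M := \sum_(i in A) _; set G := joint_mean _ _.
have hR : 1 <= h%:R :> R by rewrite (ler_nat _ 1).
have M0 : 0 <= M by apply: sumr_ge0 => i _; exact: top_mass_ge0.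
have meanXW i : joint_mean C (fun x => x i * W i (x i)) = top_mass (C i) a.
  rewrite (@joint_mean_marginal _ _ _ _ _ C i (fun y => y * W i y)) ?mul0r//.
  exact: cand_mean_mul_top_weight.
have main : 4 * h%:R * M <= 4 * h%:R * G +
    \sum_(i in A) \sum_(j in A)
      joint_mean C (fun x => x i * W i (x i) * W j (x j)).
  rewrite /M -(eq_bigr _ (fun i _ => meanXW i)) -joint_mean_sum -joint_meanZ.
  rewrite -joint_meanZ.
  under eq_bigr do rewrite -joint_mean_sum.
  rewrite -joint_mean_sum -joint_meanD; apply: joint_mean_le => x x0.
  have := sum_largest_weighted h A x0 (fun i => W01 i (x i)).
  rewrite mulrBl lerBlDr => /le_trans; apply; rewrite lerD2l.
  rewrite mulrC mulr_suml; apply: ler_sum => i _.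
  by rewrite mulr_sumr.
have pairs : \sum_(i in A) \sum_(j in A)
    joint_mean C (fun x => x i * W i (x i) * W j (x j)) <= (1 + h%:R) * M.
  rewrite mulr_sumr; apply: ler_sum => i iA.
  rewrite (bigD1 i)//= mulrDl mul1r; apply: lerD.
    rewrite -meanXW; apply: joint_mean_le => x x0.
    have /andP[w0 w1] := W01 i (x i).
    by rewrite ler_piMr// mulr_ge0.
  apply: (@le_trans _ _ (\sum_(j in A) top_mass (C i) a * a)); last first.
    rewrite sumr_const -[X in X <= _]mulr_natr -mulrA mulrC.
    by rewrite ler_wpM2r ?top_mass_ge0// mulrC.
  rewrite [leRHS](bigD1 i)//= ler_wpDl ?mulr_ge0 ?top_mass_ge0//.
  apply: ler_sum => j /andP[jA ji].
  rewrite (@joint_mean_pair _ _ _ _ _ C i j (fun y => y * W i y) (W j))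
    ?mul0r//.
    rewrite cand_mean_mul_top_weight ler_wpM2l ?top_mass_ge0//.
    exact: cand_mean_top_weight.
  by rewrite eq_sym.
(* The two bounds give (3h - 1) M <= 4h G, and 3h - 1 >= 2h as h >= 1. *)
have : 2 * h%:R * M <= 4 * h%:R * G by nra.
have -> : 4 * h%:R * G = 2 * h%:R * (2 * G) by ring.
by rewrite ler_pM2l//; lra.
Qed.

(** One h m comes from raising the threshold, the other from at most |B| mean excesses of at most a
    m each. *)
Lemma joint_mean_exchange h A B a m : 0 < a -> #|B|%:R * a <= h%:R ->
  (forall j, j \notin A -> top_mass (C j) a <= a * m) -> 0 <= m ->
  joint_mean C (fun x => sum_largest h [seq x i | i <- enum B]) <=
  joint_mean C (fun x => sum_largest h [seq x i | i <- enum A]) +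
  2 * h%:R * m.
Proof.
move=> a0 Ba Am m0.
apply: (@le_trans _ _ (joint_mean C (fun x =>
    sum_largest h [seq x i | i <- enum A] +
    (h%:R * m + \sum_(i in B :\: A) Num.max (x i - m) 0)))).
  by apply: joint_mean_le => x x0; exact: sum_largest_exchange.
rewrite !joint_meanD lerD2l joint_mean_cst joint_mean_sum.
have -> : 2 * h%:R * m = h%:R * m + h%:R * m by ring.
rewrite lerD2l; apply: (@le_trans _ _ (\sum_(i in B) a * m)); last first.
  by rewrite sumr_const -[X in X <= _]mulr_natl mulrA ler_wpM2r.
rewrite [leRHS](big_setID A) /= ler_wpDl ?sumr_ge0// => [i _|].
  by rewrite mulr_ge0// ltW.
apply: ler_sum => i; rewrite inE => /andP[iA _].
rewrite (@joint_mean_marginal _ _ _ _ _ C i (fun y => Num.max (y - m) 0)).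
  by apply: le_trans (Am i iA); apply: sum_excess_le_top_mass => //; exact: Am.
by rewrite sub0r max_r// oppr_le0.
Qed.

End Bounds.

Theorem theorem2p16 (R : realType) :
  exists mu : R,
  forall (k h : nat), (1 <= k)%N -> (1 <= h)%N -> (h <= k)%N -> (h %| k)%N ->
  forall (d : measure_display) (T : measurableType d) (P : probability T R)
    (S : finType) (C : S -> candidate P),
  mutually_independent C ->
  (k <= #|S|)%N ->
  forall X Y : {set S},
  #|X| = k ->
  (forall i j : S, i \in X -> j \notin X ->
     (top_quantile_mean h k (C j) <= top_quantile_mean h k (C i))%R) ->
  #|Y| = k ->
  (forall Z : {set S}, #|Z| = k ->
     (expected_top C h Z <= expected_top C h Y)%E) ->
  (expected_top C h Y <= mu%:E * expected_top C h X)%E.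
Proof.
(* 5 = 1 + 2 * 2: g_h(Y) <= g_h(X) + 2 h m, while h m is at most the total top mass of [X], hence at
   most 2 g_h(X). *)
exists 5%R => k h k0 h0 hk _ d T P S C indep _ X Y cX topX cY _.
rewrite !expected_topE -EFinM lee_fin.
pose a : R := (h%:R / k%:R)%R.
have a0 : (0 < a)%R by rewrite divr_gt0 ?ltr0n.
have ka : (k%:R * a = h%:R)%R by rewrite mulrC divfK// pnatr_eq0 -lt0n.
have [i0 i0X] : exists i, i \in X by apply/card_gt0P; rewrite cX.
pose i := [arg min_(i < i0 in X) top_mass (C i) a]%O.
have [iX imin] : i \in X /\
    forall j, j \in X -> (top_mass (C i) a <= top_mass (C j) a)%R.
  by rewrite /i; case: arg_minP.
pose m : R := (top_mass (C i) a / a)%R.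
have am : (a * m = top_mass (C i) a)%R by rewrite mulrC divfK// gt_eqF.
have m0 : (0 <= m)%R by rewrite divr_ge0 ?top_mass_ge0 ?ltW.
have Xm j : j \notin X -> (top_mass (C j) a <= a * m)%R.
  move=> /(topX i j iX); rewrite !top_quantile_meanE// am.
  by rewrite ler_pM2r ?invr_gt0.
have kX : (#|X|%:R * a <= h%:R)%R by rewrite cX ka.
have kY : (#|Y|%:R * a <= h%:R)%R by rewrite cY ka.
have lower := sum_top_mass_le indep h0 (ltW a0) kX.
have upper := joint_mean_exchange a0 kY Xm m0.
(* Here h m = k a m, and each of the k masses is at least the least one, a m. *)
have hm : (h%:R * m <= \sum_(i in X) top_mass (C i) a)%R.
  rewrite -ka -cX -mulrA am mulr_natl -sumr_const.
  by apply: ler_sum => j /imin.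
by move: lower upper hm; lra.
Qed.
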